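(* Let $P$ be a pregroup and $\Gamma=P\setminus\{\varepsilon\}$. Let $g$ and $f$ be cyclically reduced elements of $\Gamma^*$ such that $g$ is conjugate to $f$ in $U(P)$. Let $g=g_1\cdots g_n$ with $g_i\in P$ and $n=|g|\ge2$. Then we may obtain $f$, as an element of $U(P)$, from $g$ by a single cyclic permutation followed by a preconjugation. More precisely, there are an index $i\in\{1,\dots,n\}$ and $b\in P$ with $bg_i\in P$ and $g_{i-1}\overline b\in P$ (indices modulo $n$) such that $$f=[bg_i]\,g_{i+1}\cdots g_n\,g_1\cdots g_{i-2}\,[g_{i-1}\overline b]\quad\text{in } U(P).$$
   Context: A pregroup is a set $P$ with a distinguished element $\varepsilon$, a partial multiplication $(a,b)\mapsto ab$ defined for $(a,b)\in D\subseteq P\times P$, and an involution $a\mapsto\overline a$, such that for all $a,b,c,d\in P$: (P1) $a\varepsilon,\varepsilon a$ are defined and equal $a$; (P2) $\overline a a$, $a\overline a$ are defined and equal $\varepsilon$; (P3) if $ab$ is defined then so is $\overline b\,\overline a$, and $\overline{ab}=\overline b\,\overline a$; (P4) if $ab$ and $bc$ are defined, then $(ab)c$ is defined iff $a(bc)$ is defined, in which case they are equal; (P5) if $ab,bc,cd$ are defined then $abc$ or $bcd$ is defined. $ab\in P$ means $(a,b)\in D$, and then $[ab]\in P$ denotes the product, to distinguish it from the word $ab$ of length 2. The universal group $U(P)$ is the group $\Gamma^*/S(P)$, where $S(P)\subseteq\Gamma^*\times\Gamma^*$ consists of the rules $ab\to1$ (the empty word) if $(a,b)\in D$ and $[ab]=\varepsilon$;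 $ab\to[ab]$ if $(a,b)\in D$ and $[ab]\ne\varepsilon$; $ab\leftrightarrow[ac][\overline c b]$ if $(a,c),(\overline c,b)\in D$ and $(a,b)\notin D$. For $w\in\Gamma^*$, the cyclic word $w_\sim$ is the set of cyclic permutations $sr$ of $w=rs$. A cyclic word $w_\sim$ (and each word in it) is cyclically reduced if it is geodesic, i.e. $|w|$ is minimal among the lengths of all words in $\Gamma^*$ representing elements of $U(P)$ conjugate to $w$. For $u=a_1\cdots a_n$ with $a_i\in\Gamma$, $n\ge2$, a preconjugation of $u$ by $c\in P$ is the word $[\overline c a_1]a_2\cdots a_{n-1}[a_nc]$, where $\overline ca_1,a_nc\in P$. *)

(* Defs.v *)
From Stdlib Require Import Relations.
From HB Require Import structures.
From mathcomp Require Import all_boot.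
From mathcomp Require Import boolp.

Set Implicit Arguments.
Unset Strict Implicit.
Unset Printing Implicit Defensive.

Local Open Scope quotient_scope.

(* The partial product is option-valued: (a, b) \in D is pmul a b <> None.
   In pmulA, equality of options says at once that (ab)c is defined iff a(bc)
   is, and that both are then equal. *)
HB.mixin Record isPregroup P of Choice P := {
  peps : P;
  pmul : P -> P -> option P;
  pinv : P -> P;
  pinvK : involutive pinv;
  pmulp1 : forall a, pmul a peps = Some a;
  pmul1p : forall a, pmul peps a = Some a;
  pmulVp : forall a, pmul (pinv a) a = Some peps;
  pmulpV : forall a, pmul a (pinv a) = Some peps;
  pinvM : forall a b x,
    pmul a b = Some x -> pmul (pinv b) (pinv a) = Some (pinv x);
  pmulA : forall a b c x y,
    pmul a b = Some x -> pmul b c = Some y -> pmul x c = pmul a y;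
  pmul_dich : forall a b c d x y z,
    pmul a b = Some x -> pmul b c = Some y -> pmul c d = Some z ->
    isSome (pmul x c) \/ isSome (pmul y d)
}.

#[short(type="pregroupType")]
HB.structure Definition Pregroup := {P of isPregroup P & Choice P}.

(* The alphabet Gamma. *)
Definition letter (P : pregroupType) := {a : P | a != peps}.

(* The rules S(P). In the last one [ac] and [\bar c b] are letters
   automatically, since ab would otherwise be defined. *)
Inductive rule (P : pregroupType) : seq (letter P) -> seq (letter P) -> Prop :=
| RuleCancel (a b : letter P) of pmul (val a) (val b) = Some peps :
    rule [:: a; b] [::]
| RuleMul (a b x : letter P) of pmul (val a) (val b) = Some (val x) :
    rule [:: a; b] [:: x]
| RuleSwap (a b x y : letter P) (c : P) of
      pmul (val a) (val b) = None
    & pmul (val a) c = Some (val x) & pmul (pinv c) (val b) = Some (val y) :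
    rule [:: a; b] [:: x; y].

Inductive step (P : pregroupType) : seq (letter P) -> seq (letter P) -> Prop :=
  Step s t u v of rule u v : step (s ++ u ++ t) (s ++ v ++ t).

Definition word_cong (P : pregroupType) :
    seq (letter P) -> seq (letter P) -> Prop :=
  clos_refl_sym_trans _ (@step P).

Section UniversalGroup.
Variable P : pregroupType.
Implicit Types (a b : P) (u v w : seq (letter P)).

Definition word_congb u v : bool := `[< word_cong u v >].

Lemma word_congb_refl : reflexive word_congb.
Proof. by move=> u; apply/asboolP; apply: rst_refl. Qed.

Lemma word_congb_sym : symmetric word_congb.
Proof. by move=> u v; apply/asboolP/asboolP; apply: rst_sym. Qed.

Lemma word_congb_trans : transitive word_congb.
Proof.
by move=> v u w /asboolP uv /asboolP vw; apply/asboolP; apply: rst_trans vw.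
Qed.

Canonical word_cong_equiv :=
  EquivRel word_congb word_congb_refl word_congb_sym word_congb_trans.

Definition univ_group := {eq_quot word_congb}.

HB.instance Definition _ := EqQuotient.on univ_group.
HB.instance Definition _ := Choice.on univ_group.

Definition word_class w : univ_group := \pi_univ_group w.

Lemma word_classP u v : word_class u = word_class v <-> word_cong u v.
Proof.
split; first by move/eqmodP/asboolP.
by move=> uv; apply/eqmodP/asboolP.
Qed.

Lemma word_cong_cat u u' v v' :
  word_cong u u' -> word_cong v v' -> word_cong (u ++ v) (u' ++ v').
Proof.
move=> uu' vv'; apply: (@rst_trans _ _ _ (u' ++ v)).
- elim: uu' => [{u u'}_ _ [s t u u' r]|x|x y _|x y z _ + _].
  + by apply: rst_step; rewrite -!catA; constructor.
  + exact: rst_refl.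
  + exact: rst_sym.
  + exact: rst_trans.
- elim: vv' => [{v v'}_ _ [s t v v' r]|x|x y _|x y z _ + _].
  + by apply: rst_step; rewrite !(catA u'); constructor.
  + exact: rst_refl.
  + exact: rst_sym.
  + exact: rst_trans.
Qed.

Lemma pinv1 : pinv (peps : P) = peps.
Proof. by have := pmulVp (peps : P); rewrite pmulp1 => -[]. Qed.

Lemma pinv_neq1 a : a != peps -> pinv a != peps.
Proof. by apply: contra_neq => a1; rewrite -[a]pinvK a1 pinv1. Qed.

Definition letter_inv (a : letter P) : letter P :=
  exist _ (pinv (val a)) (pinv_neq1 (valP a)).

Definition word_inv w := rev (map letter_inv w).

Lemma word_mulVw w : word_cong (word_inv w ++ w) [::].
Proof.
elim: w => [|a w IH]; first exact: rst_refl.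
apply: rst_trans IH; apply: rst_step.
rewrite /word_inv /= rev_cons cat_rcons.
apply: (@Step P _ w [:: letter_inv a; a] [::]).
by apply: RuleCancel; rewrite /= pmulVp.
Qed.

Lemma word_mulwV w : word_cong (w ++ word_inv w) [::].
Proof.
elim/last_ind: w => [|w a IH]; first exact: rst_refl.
apply: rst_trans IH; apply: rst_step.
rewrite /word_inv map_rcons rev_rcons cat_rcons.
apply: (@Step P w _ [:: a; letter_inv a] [::]).
by apply: RuleCancel; rewrite /= pmulpV.
Qed.

Definition univ_one : univ_group := word_class [::].
Definition univ_mul (x y : univ_group) := word_class (repr x ++ repr y).
Definition univ_inv (x : univ_group) := word_class (word_inv (repr x)).

Lemma repr_word_class w : word_cong (repr (word_class w)) w.
Proof. by apply/word_classP; rewrite /word_class reprK. Qed.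

Lemma word_class_cat u v :
  word_class (u ++ v) = univ_mul (word_class u) (word_class v).
Proof.
by apply/word_classP/rst_sym/word_cong_cat; apply: repr_word_class.
Qed.

Lemma word_class_repr (x : univ_group) : word_class (repr x) = x.
Proof. exact: reprK. Qed.

Lemma univ_mulA : associative univ_mul.
Proof.
move=> x y z; rewrite -[x]word_class_repr -[y]word_class_repr.
by rewrite -[z]word_class_repr -!word_class_cat catA.
Qed.

Lemma univ_mul1x : left_id univ_one univ_mul.
Proof. by move=> x; rewrite -[x]word_class_repr -word_class_cat. Qed.

Lemma univ_mulx1 : right_id univ_one univ_mul.
Proof. by move=> x; rewrite -[x]word_class_repr -word_class_cat cats0. Qed.

Lemma univ_mulVx : left_inverse univ_one univ_inv univ_mul.
Proof.
move=> x; rewrite -[X in univ_mul _ X]word_class_repr -word_class_cat.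
by apply/word_classP/word_mulVw.
Qed.

Lemma univ_mulxV : right_inverse univ_one univ_inv univ_mul.
Proof.
move=> x; rewrite -[X in univ_mul X _]word_class_repr -word_class_cat.
by apply/word_classP/word_mulwV.
Qed.

HB.instance Definition _ := isGroup.Build univ_group
  univ_mulA univ_mul1x univ_mulx1 univ_mulVx univ_mulxV.

End UniversalGroup.

(* A word over P, in which the letter peps stands for the empty word. *)
Definition pword_class (P : pregroupType) (s : seq P) : univ_group P :=
  word_class (pmap insub s).

Definition conjugate (G : groupType) (x y : G) := exists z : G, y = (x ^ z)%g.

Definition cyclically_reduced (P : pregroupType) (w : seq (letter P)) :=
  forall v : seq (letter P),
    conjugate (word_class w) (word_class v) -> size w <= size v.

(* The shape a :: rcons w z forces u to have at least two letters. *)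
Definition preconjugation (P : pregroupType) (u : seq (letter P)) (c : P)
    (v : seq P) :=
  exists (a z : letter P) (w : seq (letter P)) (x y : P),
    [/\ u = a :: rcons w z,
        pmul (pinv c) (val a) = Some x, pmul (val z) c = Some y
      & v = x :: rcons (map val w) y].

(* Main.v *)
Require Import Defs.
From mathcomp Require Import all_boot zify.
From Stdlib Require Import Relations.

(** A word over the pregroup P is called reduced when no two neighbouring
    letters can be multiplied.  Everything rests on one fact of Stallings,
    [reduced_geodesic]: a reduced word is a shortest representative of its
    element of the universal group.

    To see this, contract words over P by multiplying two neighbouring letters.
    Two contractions of the same word either have a common contraction or
    differ by an interleaving ab ~ [ac][c^-1 b] (this is axiom P4), and
    interleaving does not affect which words can be contracted (this is where
    axiom P5 enters).  Hence in a chain of contractions, expansions and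
    interleavings that joins two words, every plateau of maximal length above
    both ends can be bypassed one level below ([link_peak]).  So such a chain
    can be kept within the length of the longer end; if that end is reduced, the
    chain can only interleave it, and both ends have the same length.

    For the theorem, let f = z^-1 g z with g = g_1 ... g_n and f cyclically
    reduced, z = z_1 ... z_m reduced, and argue by induction on m.  If
    z_1 z_2 can be rewritten to begin with g_1, or with the inverse of g_n,
    then a rotation of g is conjugate to f by a shorter word
    ([preconj_rotate]).
    - For m = 0 there is nothing to do.
    - If both z_1^-1 g_1 and g_n z_1 are in P, then m = 1 is a preconjugation.
      For m > 1, either a rotation applies, or the word obtained from z^-1 g z
      by these two multiplications is reduced and longer than f.
    - If g_n z_1 is not in P, then the word g z is reduced; z f represents the
      same element and has the same length, so it is reduced as well.
      Comparing first letters of two reduced words of equal value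
      ([reduced_eq_prefix]) yields a rotation when m > 1, and for m = 1 a
      rotation by one letter followed by a preconjugation
      ([preconj_one_sided]).
    - The case where z_1^-1 g_1 is not in P is the previous one applied to the
      inverses of g and f. *)

Set Implicit Arguments.
Unset Strict Implicit.
Unset Printing Implicit Defensive.

Arguments pmulA {s a b c x y}.
Arguments pmul_dich {s a b c d x y z}.
Arguments pinvM {s a b x}.

(** * Contraction and interleaving of words *)

Section Words.
Variable P : pregroupType.
Implicit Types (a b c d x y : P) (s t u v w : seq P).

Lemma pmul_divr a c x : pmul a c = Some x -> pmul x (pinv c) = Some a.
Proof. by move=> ac; rewrite (pmulA ac (pmulpV c)) pmulp1. Qed.

Lemma pmul_divl c b y : pmul c b = Some y -> pmul (pinv c) y = Some b.
Proof. by move=> cb; rewrite -(pmulA (pmulVp c) cb) pmul1p. Qed.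

Lemma pmul_mull c b y : pmul (pinv c) b = Some y -> pmul c y = Some b.
Proof. by move/pmul_divl; rewrite pinvK. Qed.

Lemma pinvM_None a b : pmul a b = None -> pmul (pinv b) (pinv a) = None.
Proof.
case E: (pmul (pinv b) (pinv a)) => [x|//].
by have := pinvM E; rewrite !pinvK => ->.
Qed.

Inductive contract : seq P -> seq P -> Prop :=
| ContractHead a b x t of pmul a b = Some x : contract (a :: b :: t) (x :: t)
| ContractTail d u v of contract u v : contract (d :: u) (d :: v).

Inductive interleave : seq P -> seq P -> Prop :=
| InterleaveHead a b c x y t of pmul a c = Some x & pmul (pinv c) b = Some y :
    interleave (a :: b :: t) (x :: y :: t)
| InterleaveTail d u v of interleave u v : interleave (d :: u) (d :: v).

Lemma size_contract u v : contract u v -> size u = (size v).+1.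
Proof. by elim=> //= d {}u {}v _ ->. Qed.

Lemma size_interleave u v : interleave u v -> size u = size v.
Proof. by elim=> //= d {}u {}v _ ->. Qed.

Lemma interleave_sym u v : interleave u v -> interleave v u.
Proof.
elim=> [a b c x y t ac cb|d {}u {}v _]; last exact: InterleaveTail.
apply: (InterleaveHead (c := pinv c)); first exact: pmul_divr.
by rewrite pinvK; apply: pmul_mull.
Qed.

(** How two contractions of one word, or the contractions of two interleaved
    words, turn out to differ.  Each alternative can be realised by a chain of
    words that are no longer than the two given ones. *)
Definition joined v v' :=
  [\/ v = v', interleave v v' | exists w, contract v w /\ contract v' w].

Lemma joined_cons d v v' : joined v v' -> joined (d :: v) (d :: v').
Proof.
case=> [->|vv'|[w [vw v'w]]]; first by constructor 1.
  by constructor 2; apply: InterleaveTail.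
by constructor 3; exists (d :: w); split; apply: ContractTail.
Qed.

Lemma joined_sym v v' : joined v v' -> joined v' v.
Proof.
case=> [->|/interleave_sym|[w [vw v'w]]]; first by constructor 1.
  by constructor 2.
by constructor 3; exists w.
Qed.

(** The two ways of contracting a triple abc are interleavings of each other,
    with b itself as the transferred element. *)
Lemma interleave_assoc a b c x y t :
  pmul a b = Some x -> pmul b c = Some y ->
  interleave (x :: c :: t) (a :: y :: t).
Proof.
move=> ab bc; apply: (InterleaveHead (c := pinv b)); first exact: pmul_divr.
by rewrite pinvK.
Qed.

(** Local confluence.  Contractions at disjoint places commute, and
    [interleave_assoc] settles those that share a letter. *)
Lemma contract_joined u v v' : contract u v -> contract u v' -> joined v v'.
Proof.
move=> uv; elim: uv v' => [a b x t ab|d {}u {}v uv IH] v' uv'.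
  inversion uv' as [a' b' x' t' ab' [ea eb et] ev|d' u' w' bt [ed eu] ev].
    by move: ab'; rewrite ab => -[->]; constructor 1.
  inversion bt as [b1 c y t1 bc [eb et] ey|d1 u1 w1 tw [eb et] ew].
    by constructor 2; apply: interleave_assoc ab bc.
  constructor 3; exists (x :: w1); split; first exact: ContractTail.
  exact: ContractHead.
inversion uv' as [a b x t ab [ea et] ev|d' u' w' uw [ed eu] ev].
  subst; inversion uv as [b1 c y t1 bc [eb ec] ey|d1 u1 w1 tw [eb et] ew].
    by constructor 2; apply: interleave_sym; apply: interleave_assoc ab bc.
  constructor 3; exists (x :: w1); split; last exact: ContractTail.
  exact: ContractHead.
exact/joined_cons/IH.
Qed.

(** Local coherence.  Let ab become [ac][c^-1 b].  A contraction away from the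
    pair is unaffected, and one of the pair itself has the same result.  For one
    of the pair with a neighbour, say da, axiom P5 for the chain d, a, c,
    c^-1 b gives that d[ac] or ab is in P; in either case the new word has a
    contraction that is an interleaving of the given one. *)
Lemma interleave_contract u u' v :
  interleave u u' -> contract u v -> exists v', contract u' v' /\ joined v v'.
Proof.
move=> uu'; elim: uu' v => [a b c x y t ac cb|d {}u {}u' uu' IH] v uv.
  have abE : pmul x y = pmul a b.
    by rewrite -(pmulA (pmul_divr ac) cb).
  inversion uv as [a' b' z t' ab [ea eb et] ev|d0 u0 w0 bt [ed eu] ev]; subst.
    by exists (z :: t); split; [apply: ContractHead; rewrite abE|constructor 1].
  inversion bt as [b1 d z t1 bd [eb et] ey|d1 u1 w1 tw [eb et] ew]; subst.
    (* The right neighbour d: P5 for ac, c^-1, b, d. *)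
    have [] := pmul_dich (pmul_divr ac) cb bd.
      rewrite -abE; case E: (pmul x y) => [r|//] _.
      exists (r :: d :: t1); split; first exact: ContractHead.
      by constructor 2; apply/interleave_sym/interleave_assoc/bd; rewrite -abE.
    case E: (pmul y d) => [r|//] _; exists (x :: r :: t1).
    split; first exact/ContractTail/ContractHead.
    constructor 2; apply: InterleaveHead ac _.
    by rewrite -(pmulA cb bd).
  exists (x :: y :: w1); split; first exact/ContractTail/ContractTail.
  by constructor 2; apply: InterleaveHead ac cb.
inversion uv as [d' a z t da [ed et] ev|d' u1 w1 uw [ed eu] ev]; subst;
  last first.
  have [v' [uv' vv']] := IH _ uw.
  by exists (d :: v'); split; [apply: ContractTail | apply: joined_cons].
inversion uu' as [a' b c x y t1 ac cb [ea eb] ey|d1 u1 w1 tw [eb et] ew]; subst;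
  last first.
  by exists (z :: w1); split;
    [apply: ContractHead | constructor 2; apply: InterleaveTail].
have abE : pmul x y = pmul a b.
  by rewrite -(pmulA (pmul_divr ac) cb).
(* The left neighbour d: P5 for d, a, c, c^-1 b. *)
have [] := pmul_dich da ac (pmul_mull cb).
  case E: (pmul z c) => [r|//] _; exists (r :: y :: t1).
  split; last by constructor 2; apply: InterleaveHead E cb.
  by apply: ContractHead; rewrite -(pmulA da ac).
case E: (pmul x y) => [r|//] _; exists (d :: r :: t1).
split; first exact/ContractTail/ContractHead.
by constructor 2; apply: interleave_assoc da _; rewrite -abE.
Qed.

(** * Reduced words are geodesic *)

(** Neither kind of step increases the length from u to v, so the condition on
    u bounds all words of a chain. *)
Definition link N := clos_refl_sym_trans _
  (fun u v => size u <= N /\ (contract u v \/ interleave u v)).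

Lemma link_leq M N u v : M <= N -> link M u v -> link N u v.
Proof.
move=> MN; elim=> {u v} [u v [uM uv]|u|u v _|u v w _ + _].
- by apply: rst_step; split=> //; apply: leq_trans MN.
- exact: rst_refl.
- exact: rst_sym.
- exact: rst_trans.
Qed.

Lemma link_joined N v v' :
  size v <= N -> size v' <= N -> joined v v' -> link N v v'.
Proof.
move=> vN v'N [->|vv'|[w [vw v'w]]]; first exact: rst_refl.
  by apply: rst_step; split=> //; right.
by apply: (@rst_trans _ _ _ w); [|apply: rst_sym]; apply: rst_step;
  split=> //; left.
Qed.

(** Peak reduction.  The invariant of a word w on the chain is that w is
    already linked to u below, or that w lies on the plateau, can be contracted,
    and all its contractions are linked to u below.  Confluence propagates it
    when the chain climbs to the plateau, coherence when it moves along. *)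
Lemma link_peak N u v :
  size u <= N -> size v <= N -> link N.+1 u v -> link N u v.
Proof.
move=> uN vN uv.
pose good w := size w <= N /\ link N u w \/
  [/\ size w = N.+1, exists v', contract w v' &
      forall v', contract w v' -> link N u v'].
suff: good u <-> good v.
  case=> + _; case; first by left; split=> //; apply: rst_refl.
    by case.
  by case=> vN1; move: vN; rewrite vN1 ltnn.
have interleave_good w w' :
    size w <= N.+1 -> interleave w w' -> good w -> good w'.
  move=> wN ww' [[wN' uw]|[wN' [y wy] uw]].
    left; split; first by rewrite -(size_interleave ww').
    by apply: rst_trans uw _; apply: rst_step; split=> //; right.
  right; split; first by rewrite -(size_interleave ww').
    by have [y' [wy' _]] := interleave_contract ww' wy; exists y'.
  move=> y' wy'.
  have [y1 [wy1 yy1]] := interleave_contract (interleave_sym ww') wy'.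
  apply: rst_trans (uw _ wy1) _; apply: link_joined (joined_sym yy1).
    by rewrite -ltnS -(size_contract wy1) wN'.
  by rewrite -ltnS -(size_contract wy') -(size_interleave ww') wN'.
elim: uv => {v vN} [w w' [wN ww']|w|w w' _ []|x y z _ [? ?] _ [? ?]] //;
  last by split; auto.
case: ww' => ww'; last first.
  by split; apply: interleave_good => //;
    [rewrite -(size_interleave ww') | apply: interleave_sym].
have w'N : size w' <= N by rewrite -ltnS -(size_contract ww').
split; case=> [[wN1 uw]|[wN' _ uw]].
- left; split=> //; apply: rst_trans uw _; apply: rst_step; split=> //; by left.
- by left; split=> //; apply: uw.
- move: wN; rewrite leq_eqVlt => /orP[/eqP wN|wN].
    right; split=> //; first by exists w'.
    move=> y wy; apply: rst_trans uw _.
    apply: link_joined (contract_joined ww' wy) => //.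
    by rewrite -ltnS -(size_contract wy) wN.
  left; split=> //; apply: rst_trans uw _; apply: rst_sym.
  by apply: rst_step; split=> //; left.
- by move: w'N; rewrite wN' ltnn.
Qed.

(** On nonempty words over P this is equality in the universal group: the
    rule ab -> 1 amounts to contracting ab to [peps], which then multiplies with
    any neighbour.  A letter [peps] put in front provides one. *)
Definition contract_eq := clos_refl_sym_trans _ contract.

Lemma contract_eq_sym u v : contract_eq u v -> contract_eq v u.
Proof. exact: rst_sym. Qed.

Lemma contract_eq_trans v u w :
  contract_eq u v -> contract_eq v w -> contract_eq u w.
Proof. exact: rst_trans. Qed.

Lemma contract_eq_step u v : contract u v -> contract_eq u v.
Proof. exact: rst_step. Qed.

Definition reduced := sorted (fun a b : P => pmul a b == None).

Lemma reducedPn u : reflect (exists v, contract u v) (~~ reduced u).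
Proof.
apply: (iffP idP) => [|[v]].
  elim: u => [|a [|b u] IH] //=.
  rewrite negb_and; case E: (pmul a b) => [x|] /=.
    by exists (x :: u); apply: ContractHead.
  by case/IH => v uv; exists (a :: v); apply: ContractTail.
elim=> {u v} [a b x t ab|d [|b u] v uv IH] /=; first by rewrite ab.
  by inversion uv.
by rewrite negb_and IH orbT.
Qed.

(** Within length N a reduced word of length N can neither be expanded nor
    contracted, and by coherence interleaving keeps it reduced. *)
Lemma link_reduced N u v : size u = N -> reduced u -> link N u v -> size v = N.
Proof.
move=> uN u_red uv; pose good w := size w = N /\ reduced w.
suff [uv' _]: good u <-> good v by have [] := uv' (conj uN u_red).
have interleave_good w w' : interleave w w' -> good w -> good w'.
  move=> ww' [wN w_red]; split; first by rewrite -(size_interleave ww').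
  move: w_red; apply: contraLR => /reducedPn[v' wv']; apply/reducedPn.
  have [v1 [wv1 _]] := interleave_contract (interleave_sym ww') wv'.
  by exists v1.
elim: uv {uN u_red} =>
    {u v} [w w' [wN ww']|w|w w' _ []|x y z _ [? ?] _ [? ?]] //;
  last by split; auto.
case: ww' => ww'; last first.
  by split; apply: interleave_good => //; apply: interleave_sym.
have /negP w_nred : ~~ reduced w by apply/reducedPn; exists w'.
split; first by case=> _ /w_nred.
by case=> w'N; move: wN; rewrite (size_contract ww') w'N ltnn.
Qed.

Lemma contract_eq_link u v : contract_eq u v -> exists N, link N u v.
Proof.
elim=> {u v} [u v uv|u|u v _ [N uv]|u v w _ [M uv] _ [N vw]].
- by exists (size u); apply: rst_step; split=> //; left.
- by exists 0; apply: rst_refl.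
- by exists N; apply: rst_sym.
exists (maxn M N); apply: (@rst_trans _ _ _ v).
  exact: link_leq (leq_maxl _ _) uv.
exact: link_leq (leq_maxr _ _) vw.
Qed.

(** If u were longer than v, then [link_peak] would lower the chain to the
    length of u, where [link_reduced] leaves no way to a shorter word. *)
Lemma reduced_contract_eq_size u v :
  reduced u -> contract_eq u v -> size u <= size v.
Proof.
move=> u_red /contract_eq_link[N uv]; rewrite leqNgt; apply/negP => vu.
have {}uv : link (size u) u v.
  have [Nu|/ltnW uN] := leqP N (size u); first exact: link_leq uv.
  move: uv; rewrite -(subnK uN); elim: (N - size u) => // k IH uv.
  apply/IH/link_peak => //; first by rewrite leq_addl.
  by rewrite (leq_trans (ltnW vu)) ?leq_addl.
by move: vu; rewrite (link_reduced _ u_red uv) ?ltnn.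
Qed.

Lemma contract_eq_cons d u v : contract_eq u v -> contract_eq (d :: u) (d :: v).
Proof.
elim=> {u v} [u v uv|u|u v _|u v w _ + _].
- exact/rst_step/ContractTail.
- exact: rst_refl.
- exact: rst_sym.
- exact: rst_trans.
Qed.

Lemma contract_eq_catl s u v : contract_eq u v -> contract_eq (s ++ u) (s ++ v).
Proof. by move=> uv; elim: s => //= d s; apply: contract_eq_cons. Qed.

Lemma contract_eq_peps d s t : contract_eq (d :: s ++ peps :: t) (d :: s ++ t).
Proof.
elim: s d => [|a s IH] d; last exact/contract_eq_cons/IH.
exact/contract_eq_step/ContractHead/pmulp1.
Qed.

Lemma word_cong_contract_eq (u v : seq (letter P)) :
  word_cong u v -> contract_eq (peps :: map val u) (peps :: map val v).
Proof.
elim=> {u v} [_ _ [s t u v r]|u|u v _|u v w _ + _];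
  [|exact: rst_refl|exact: contract_eq_sym|exact: contract_eq_trans].
rewrite !map_cat; move: (map val s) (map val t) => {}s {}t.
rewrite -!cat_cons; case: r => {u v} /= [a b ab|a b x ab|a b x y c ab ac cb].
- apply: contract_eq_trans (contract_eq_peps peps s t).
  exact/contract_eq_cons/contract_eq_catl/contract_eq_step/ContractHead.
- exact/contract_eq_cons/contract_eq_catl/contract_eq_step/ContractHead.
- apply/contract_eq_cons/contract_eq_catl.
  (* An interleaving goes through the common expansion [ac], c^-1, b. *)
  apply: (@contract_eq_trans [:: val x, pinv c, val b & t]).
    exact/contract_eq_sym/contract_eq_step/ContractHead/pmul_divr.
  exact/contract_eq_step/ContractTail/ContractHead.
Qed.

Lemma contract_eq_insub d u :
  contract_eq (d :: u) (d :: map val (pmap insub u : seq (letter P))).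
Proof.
elim: u d => [|a u IH] d /=; first exact: rst_refl.
case: insubP => [b _ ba|] /=; first by rewrite ba; apply/contract_eq_cons/IH.
rewrite negbK => /eqP->; apply: contract_eq_trans (IH d).
exact/contract_eq_step/ContractHead/pmulp1.
Qed.

(** The assumption on the length excludes the word consisting of [peps] alone,
    which is reduced but represents the identity. *)
Lemma reduced_geodesic u v :
  1 < size u -> reduced u -> pword_class u = pword_class v -> size u <= size v.
Proof.
move=> u1 u_red /word_classP/word_cong_contract_eq uv.
have {uv} : contract_eq u (peps :: v).
  apply: contract_eq_trans (contract_eq_sym (contract_eq_insub _ v)).
  apply: contract_eq_trans uv; apply: contract_eq_trans (contract_eq_insub _ u).
  case: (u) u1 => // a u' _.
  exact/contract_eq_sym/contract_eq_step/ContractHead/pmul1p.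
case: v => [|b v] uv.
  by move: u1; rewrite ltnNge (reduced_contract_eq_size u_red uv).
apply: (reduced_contract_eq_size u_red); apply: contract_eq_trans uv _.
exact/contract_eq_step/ContractHead/pmul1p.
Qed.

(** * Words in the universal group *)

Section Group.
Local Open Scope group_scope.

Definition gen a : univ_group P := pword_class [:: a].

Lemma pword_cat s t : pword_class (s ++ t) = pword_class s * pword_class t.
Proof. by rewrite /pword_class pmap_cat word_class_cat. Qed.

Lemma pword_cons a s : pword_class (a :: s) = gen a * pword_class s.
Proof. by rewrite -cat1s pword_cat. Qed.

Lemma pword_rcons a s : pword_class (rcons s a) = pword_class s * gen a.
Proof. by rewrite -cats1 pword_cat. Qed.

Lemma pword_nil : pword_class [::] = 1 :> univ_group P.
Proof. by []. Qed.

Lemma gen_peps : gen peps = 1.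
Proof. by rewrite /gen /pword_class /= insubF ?eqxx. Qed.

Lemma gen_mul a b x : pmul a b = Some x -> gen x = gen a * gen b.
Proof.
move=> ab; have [a1|a1] := eqVneq a peps.
  by move: ab; rewrite a1 pmul1p gen_peps mul1g => -[->].
have [b1|b1] := eqVneq b peps.
  by move: ab; rewrite b1 pmulp1 gen_peps mulg1 => -[->].
rewrite -pword_cons /gen /pword_class /=.
rewrite (insubT (fun c => c != peps) a1) (insubT (fun c => c != peps) b1) /=.
apply/word_classP/rst_sym/rst_step.
case: insubP => [y _ yx|] /=.
  by apply: (@Step P [::] [::] [:: _; _] [:: _]); apply: RuleMul; rewrite /= yx.
rewrite negbK => /eqP x1.
apply: (@Step P [::] [::] [:: _; _] [::]).
by apply: RuleCancel; rewrite /= ab x1.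
Qed.

Lemma gen_inv a : gen (pinv a) = (gen a)^-1.
Proof.
by apply/esym/mulg1_eq; rewrite -gen_peps; apply/esym/gen_mul/pmulpV.
Qed.

Lemma pword_contract u v : contract u v -> pword_class u = pword_class v.
Proof.
elim=> {u v} [a b x t ab|d u v _ IH]; last by rewrite !pword_cons IH.
by rewrite !pword_cons (gen_mul ab) mulgA.
Qed.

Definition pword_inv s := rev (map pinv s).

Lemma pword_inv_cons a s : pword_inv (a :: s) = rcons (pword_inv s) (pinv a).
Proof. by rewrite /pword_inv /= rev_cons. Qed.

Lemma pword_inv_rcons a s : pword_inv (rcons s a) = pinv a :: pword_inv s.
Proof. by rewrite /pword_inv map_rcons rev_rcons. Qed.

Lemma pword_invK : involutive pword_inv.
Proof. by move=> s; rewrite /pword_inv map_rev revK (mapK (@pinvK P)). Qed.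

Lemma size_pword_inv s : size (pword_inv s) = size s.
Proof. by rewrite size_rev size_map. Qed.

Lemma pword_class_inv s : pword_class (pword_inv s) = (pword_class s)^-1.
Proof.
elim: s => [|a s IH]; first by rewrite pword_nil invg1.
by rewrite pword_inv_cons pword_rcons pword_cons IH gen_inv invgM.
Qed.

Lemma reduced_inv s : reduced s -> reduced (pword_inv s).
Proof.
rewrite /reduced rev_sorted sorted_map; apply: sub_sorted => a b /eqP ab /=.
by rewrite (pinvM_None ab).
Qed.

Lemma reduced_cat s x y t :
  reduced (rcons s x ++ y :: t) =
  [&& reduced (rcons s x), pmul x y == None & reduced (y :: t)].
Proof.
case: s => [|b s] /=; first by [].
by rewrite cat_path /= last_rcons.
Qed.

Lemma geodesic_reduced u v :
  1 < size u -> reduced u -> pword_class v = pword_class u ->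
  size v <= size u -> reduced v.
Proof.
move=> u1 u_red vu sz; apply/negP => /negP/reducedPn[w vw].
have := reduced_geodesic u1 u_red (etrans (esym vu) (pword_contract vw)).
by rewrite leqNgt -(size_contract vw) sz.
Qed.

(** Multiplying by y^-1 turns x x2 u into c x2 u and y v into the shorter word
    v; so c x2 u cannot be reduced, and only its first two letters can
    multiply. *)
Lemma reduced_eq_prefix x x2 u y v c :
  reduced (x :: x2 :: u) -> pword_class (x :: x2 :: u) = pword_class (y :: v) ->
  size v <= (size u).+1 -> pmul (pinv y) x = Some c ->
  exists k, pmul c x2 = Some k.
Proof.
move=> u_red uv sz yx; case E: (pmul c x2) => [k|]; first by exists k.
have c_red : reduced (c :: x2 :: u) by move: u_red => /=; rewrite E => /andP[].
suff cuv : pword_class (c :: x2 :: u) = pword_class v.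
  have /leq_trans/(_ sz) := @reduced_geodesic (c :: x2 :: u) v isT c_red cuv.
  by rewrite ltnn.
rewrite pword_cons (gen_mul yx) gen_inv -mulgA -pword_cons uv pword_cons.
by rewrite mulKg.
Qed.

(** * Conjugation of cyclically reduced words *)

(** Cyclic reducedness for words over P, so that letters produced by the
    partial product need not be shown to differ from the identity. *)
Definition cyc_minimal g := forall v : seq P,
  conjugate (pword_class g) (pword_class v) -> size g <= size v.

Lemma conjugate_sym (G : groupType) (x y : G) : conjugate x y -> conjugate y x.
Proof. by case=> z ->; exists z^-1; rewrite conjgK. Qed.

Lemma conjugate_trans (G : groupType) (y x z : G) :
  conjugate x y -> conjugate y z -> conjugate x z.
Proof. by case=> s -> [t ->]; exists (s * t); rewrite conjgM. Qed.

Lemma conjugate_inv (G : groupType) (x y : G) :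
  conjugate x y -> conjugate x^-1 y^-1.
Proof. by case=> z ->; exists z; rewrite conjVg. Qed.

Lemma cyc_minimal_conj g v :
  cyc_minimal g -> conjugate (pword_class g) (pword_class v) ->
  size v <= size g -> cyc_minimal v.
Proof.
move=> g_min gv sz w vw; apply: leq_trans sz (g_min _ _).
exact: conjugate_trans vw.
Qed.

Lemma cyc_minimal_inv g : cyc_minimal g -> cyc_minimal (pword_inv g).
Proof.
move=> g_min v; rewrite pword_class_inv size_pword_inv => /conjugate_inv.
by rewrite invgK -pword_class_inv => /g_min; rewrite size_pword_inv.
Qed.

Lemma cyc_minimal_reduced g : cyc_minimal g -> reduced g.
Proof.
move=> g_min; apply/negP => /negP/reducedPn[w gw].
have /g_min : conjugate (pword_class g) (pword_class w).
  by exists 1; rewrite conjg1 (pword_contract gw).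
by rewrite (size_contract gw) ltnn.
Qed.

(** Quantifying over all rotations makes this property invariant under rotation
    of g, and under inversion of g and F; the proof uses both. *)
Definition cyc_preconj g (F : univ_group P) :=
  exists j a w y b p q, [/\ rot j g = a :: rcons w y, pmul b a = Some p,
    pmul y (pinv b) = Some q & F = pword_class (p :: rcons w q)].

Lemma cyc_preconj_rot i g F : cyc_preconj (rot i g) F -> cyc_preconj g F.
Proof.
case=> j [a [w [y [b [p [q]]]]]]; rewrite rot_rot_add => H.
by exists (rot_add g i j), a, w, y, b, p, q.
Qed.

Lemma cyc_preconj_inv g F : cyc_preconj (pword_inv g) F^-1 -> cyc_preconj g F.
Proof.
case=> j [a [w [y [b [p [q [gE ba yb FE]]]]]]].
exists (size g - j), (pinv y), (pword_inv w), (pinv a), b, (pinv q), (pinv p).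
split.
- apply: (can_inj pword_invK).
  rewrite pword_inv_cons pword_inv_rcons pword_invK !pinvK rcons_cons -gE.
  rewrite /pword_inv -/(rotr j g) map_rotr rev_rotr //.
- by rewrite -[b]pinvK (pinvM yb).
- exact: (pinvM ba).
- rewrite -[F]invgK FE -pword_class_inv pword_inv_cons pword_inv_rcons.
  by rewrite rcons_cons.
Qed.

Lemma pword_rot a s :
  pword_class (rot 1 (a :: s)) = pword_class (a :: s) ^ gen a.
Proof.
by rewrite rot1_cons pword_rcons pword_cons conjgE !mulgA mulVg mul1g.
Qed.

(** The induction hypothesis on the length of the conjugating word. *)
Definition preconj_below m := forall g z f : seq P,
  size z < m -> 1 < size g -> cyc_minimal g -> size f <= size g ->
  pword_class f = pword_class g ^ pword_class z -> cyc_preconj g (pword_class f).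

(** Here a = b h and h^-1 c = k give b c = a k, so the conjugating word may be
    taken to begin with the first letter a of g.  Conjugation by a rotates g,
    and what remains, k z, is one letter shorter. *)
Lemma preconj_rotate m a s b c z f h k :
  preconj_below m -> size (b :: c :: z) <= m -> 1 < size (a :: s) ->
  cyc_minimal (a :: s) -> size f <= size (a :: s) ->
  pword_class f = pword_class (a :: s) ^ pword_class (b :: c :: z) ->
  pmul (pinv b) a = Some h -> pmul (pinv h) c = Some k ->
  cyc_preconj (a :: s) (pword_class f).
Proof.
move=> IH zm g1 g_min sz fE ba hc.
apply: (@cyc_preconj_rot 1%N); apply: (IH _ (k :: z)); rewrite ?size_rot //.
  apply: cyc_minimal_conj g_min _ _; last by rewrite size_rot.
  by exists (gen a); rewrite pword_rot.
rewrite pword_rot -conjgM fE !pword_cons (gen_mul hc) gen_inv (gen_mul ba).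
by rewrite gen_inv invgM invgK !mulgA mulgV mul1g.
Qed.

(** The word g z is reduced, and z f has the same value and length.  The second
    letter of g z gives [h a2], the second letter of z f, if it belongs to z,
    gives a rotation. *)
Lemma preconj_one_sided m a a2 s b z f :
  preconj_below m -> size (b :: z) <= m ->
  cyc_minimal [:: a, a2 & s] -> size f <= size [:: a, a2 & s] ->
  pword_class f = pword_class [:: a, a2 & s] ^ pword_class (b :: z) ->
  reduced (b :: z) -> pmul (last a2 s) b = None ->
  cyc_preconj [:: a, a2 & s] (pword_class f).
Proof.
set g := [:: a, a2 & s] => IH zm g_min sz fE z_red sb.
have g_red := cyc_minimal_reduced g_min.
have gz_red : reduced (g ++ b :: z).
  by rewrite /g [_ :: _ :: _]lastI reduced_cat -lastI g_red /= sb.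
have zfE : pword_class ((b :: z) ++ f) = pword_class (g ++ b :: z).
  by rewrite !pword_cat fE -conjgC.
have zf_red : reduced ((b :: z) ++ f).
  apply: geodesic_reduced gz_red zfE _; first by rewrite size_cat.
  by rewrite !size_cat addnC leq_add2r.
(* Otherwise z^-1 g z would be reduced and longer than f. *)
have [h ba] : exists h, pmul (pinv b) a = Some h.
  case E: (pmul (pinv b) a) => [h|]; first by exists h.
  have : reduced (pword_inv (b :: z) ++ g ++ b :: z).
    rewrite pword_inv_cons /g reduced_cat -pword_inv_cons reduced_inv //= E.
    exact: gz_red.
  move=> zgz_red; have := @reduced_geodesic _ f _ zgz_red.
  rewrite !pword_cat pword_class_inv -conjgE -fE !size_cat size_pword_inv.
  by move=> /(_ _ erefl); move: sz => /=; lia.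
have [k hk] : exists k, pmul h a2 = Some k.
  apply: (@reduced_eq_prefix a _ (s ++ b :: z) b (z ++ f)) gz_red (esym zfE) _ ba.
  by move: sz; rewrite !size_cat /=; lia.
have gf : size g <= size f by apply: g_min; exists (pword_class (b :: z)).
case: z => [|c z] in zm fE z_red gz_red zfE zf_red *; last first.
  have [k' hc] : exists k', pmul (pinv h) c = Some k'.
    apply: (@reduced_eq_prefix b _ (z ++ f) a (a2 :: s ++ b :: c :: z)) => //.
      by move: gf; rewrite /g /= !size_cat /=; lia.
    by have := pinvM ba; rewrite pinvK.
  exact: (@preconj_rotate m a (a2 :: s)) IH zm isT g_min sz fE ba hc.
(* Here a = b h, so the rotated word a2 s a is preconjugated by h^-1. *)
exists 1%N, a2, s, a, h, k, b; split => //.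
- by rewrite /g rot1_cons.
- exact/pmul_divr/pmul_mull.
- rewrite fE conjgE !pword_cons pword_rcons (gen_mul hk) (gen_mul ba) gen_inv.
  by rewrite pword_nil mulg1 !mulgA.
Qed.

Lemma conj_inv g z f :
  1 < size g -> cyc_minimal g -> size f <= size g ->
  pword_class f = pword_class g ^ pword_class z ->
  [/\ 1 < size (pword_inv g), cyc_minimal (pword_inv g),
      size (pword_inv f) <= size (pword_inv g) &
      pword_class (pword_inv f) = pword_class (pword_inv g) ^ pword_class z].
Proof.
move=> g1 g_min sz fE; rewrite !size_pword_inv; split=> //.
  exact: cyc_minimal_inv.
by rewrite !pword_class_inv conjVg fE.
Qed.

Lemma cyc_preconj_of_conj g z f :
  1 < size g -> cyc_minimal g -> size f <= size g ->
  pword_class f = pword_class g ^ pword_class z -> cyc_preconj g (pword_class f).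
Proof.
have [m] := ubnP (size z); elim: m => // m IH in g z f *; rewrite ltnS => zm.
move=> g1 g_min sz fE; have [g1' g_min' sz' fE'] := conj_inv g1 g_min sz fE.
have IHm : preconj_below m by move=> *; apply: IH; eassumption.
have invP : cyc_preconj (pword_inv g) (pword_class (pword_inv f)) ->
            cyc_preconj g (pword_class f).
  by rewrite pword_class_inv; apply: cyc_preconj_inv.
have [z_red|/reducedPn[z' zz']] := boolP (reduced z); last first.
  by apply: (IHm g z'); rewrite -?(pword_contract zz') // -(size_contract zz').
case: g => [|a g] // in g1 g_min sz fE g1' g_min' sz' fE' invP *.
case/lastP: g => [|w y] // in g1 g_min sz fE g1' g_min' sz' fE' invP *.
rewrite pword_inv_cons pword_inv_rcons rcons_cons in g1' g_min' sz' fE' invP.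
case: z => [|b z] in zm fE fE' z_red *.
  exists 0%N, a, w, y, peps, a, y; rewrite rot0 pinv1 pmul1p pmulp1; split=> //.
  by rewrite fE conjg1.
(* The second letter of g is the first letter of w, or y if w is empty. *)
case yb: (pmul y b) => [e|]; last first.
  case: w => [|a2 w] in g1 g_min sz fE g1' g_min' sz' fE' invP *.
    exact: preconj_one_sided IHm zm g_min sz fE z_red yb.
  apply: preconj_one_sided IHm zm g_min sz fE z_red _.
  by rewrite last_rcons.
case ba: (pmul (pinv b) a) => [h|]; last first.
  apply: invP; have ab : pmul (pinv a) b = None.
    by rewrite -[b]pinvK pinvM_None.
  case/lastP: w => [|w a2] in g1 g_min sz fE g1' g_min' sz' fE' *.
    exact: preconj_one_sided IHm zm g_min' sz' fE' z_red ab.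
  rewrite pword_inv_rcons in g1' g_min' sz' fE' *.
  apply: preconj_one_sided IHm zm g_min' sz' fE' z_red _.
  by rewrite last_rcons.
case: z => [|c z] in zm fE fE' z_red *.
  exists 0%N, a, w, y, (pinv b), h, e; rewrite rot0 pinvK; split=> //.
  rewrite fE conjgE !pword_cons !pword_rcons (gen_mul ba) (gen_mul yb) gen_inv.
  by rewrite pword_nil mulg1 !mulgA.
case hc: (pmul (pinv h) c) => [k|].
  exact: preconj_rotate IHm zm g1 g_min sz fE ba hc.
case ec: (pmul e c) => [k|].
  apply: invP; rewrite -[e]pinvK in ec.
  exact: preconj_rotate IHm zm g1' g_min' sz' fE' (pinvM yb) ec.
(* No rotation applies: the middle part of z^-1 g z collapses to the cyclically
   minimal word h w e of the same length as g, and nothing else can multiply. *)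
have hwe_min : cyc_minimal (h :: rcons w e).
  apply: cyc_minimal_conj g_min _ _; last by rewrite /= !size_rcons.
  exists (gen b); rewrite !pword_cons !pword_rcons (gen_mul ba) (gen_mul yb).
  by rewrite gen_inv conjgE !mulgA.
have W_red : reduced (pword_inv (c :: z) ++ (h :: rcons w e) ++ c :: z).
  rewrite pword_inv_cons cat_cons reduced_cat -pword_inv_cons -cat_cons.
  rewrite -rcons_cons reduced_cat rcons_cons (cyc_minimal_reduced hwe_min) ec /=.
  have cz_red : reduced (c :: z) by case/andP: z_red.
  by rewrite reduced_inv // -[h]pinvK pinvM_None.
have := @reduced_geodesic _ f _ W_red.
have -> : pword_class (pword_inv (c :: z) ++ (h :: rcons w e) ++ c :: z) =
          pword_class f.
  rewrite fE conjgE !pword_cat pword_class_inv !pword_cons !pword_rcons.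
  by rewrite (gen_mul ba) (gen_mul yb) gen_inv !invgM !mulgA.
move=> /(_ _ erefl); move: sz; rewrite !size_cat size_pword_inv /= !size_rcons.
by lia.
Qed.
End Group.
End Words.

(** * Indices modulo the length *)

Lemma nth_rot (T : Type) (x0 : T) (s : seq T) i k :
  i < size s -> k < size s -> nth x0 (rot i s) k = nth x0 s ((i + k) %% size s).
Proof.
move=> i_s k_s; rewrite /rot nth_cat size_drop.
case: ltnP => ks; first by rewrite nth_drop modn_small //; lia.
rewrite nth_take; last by lia.
congr nth; rewrite -(subnK (n := i + k) (m := size s)); last by lia.
by rewrite modnDr modn_small; lia.
Qed.

Lemma word_class_val (P : pregroupType) (w : seq (letter P)) :
  word_class w = pword_class (map val w).
Proof. by rewrite /pword_class (map_pK valK). Qed.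

Lemma cyclically_reduced_minimal (P : pregroupType) (g : seq (letter P)) :
  cyclically_reduced g -> cyc_minimal (map val g).
Proof.
move=> g_red v; rewrite -word_class_val => /g_red; rewrite size_map.
by move/leq_trans; apply; rewrite size_pmap count_size.
Qed.

Theorem theorem4p6 (P : pregroupType) (n : nat) (g : n.-tuple (letter P))
    (f : seq (letter P)) (n_ge2 : 2 <= n)
    (g_red : cyclically_reduced g) (f_red : cyclically_reduced f)
    (gf_conj : conjugate (word_class g) (word_class f)) :
  exists (i : 'I_n) (b p q : P),
    let v := p :: rcons [seq nth peps (map val g) ((i + k) %% n)
                        | k <- iota 1 (n - 2)] q in
    [/\ pmul b (val (tnth g i)) = Some p,
        pmul (val (tnth g (ord_pred i))) (pinv b) = Some q,
        preconjugation (rot i g) (pinv b) v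
      & word_class f = pword_class v].
Proof.
have [j [a [w [y [b [p [q [gE ba yb fE]]]]]]]] :
    cyc_preconj (map val g) (word_class f).
  have [z fz] := gf_conj; rewrite word_class_val.
  apply: (@cyc_preconj_of_conj _ _ (map val (repr z))).
  - by rewrite size_map size_tuple.
  - exact: cyclically_reduced_minimal.
  - by rewrite !size_map; apply/f_red/conjugate_sym.
  - by rewrite -!word_class_val word_class_repr.
(* Rotation by n or more letters is the identity, as is rotation by 0. *)
have [i {}gE] : exists i : 'I_n, rot i (map val g) = a :: rcons w y.
  have [jn|nj] := ltnP j n; first by exists (Ordinal jn).
  exists (Ordinal (ltnW n_ge2)); rewrite rot0 -gE.
  by rewrite rot_oversize // size_map size_tuple.
have wE : w = [seq nth peps (map val g) ((i + k) %% n) | k <- iota 1 (n - 2)].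
  have := congr1 size gE; rewrite size_rot size_map size_tuple /= size_rcons => nw.
  apply: (@eq_from_nth _ peps); first by rewrite size_map size_iota nw !subSS subn0.
  move=> k kw; rewrite (nth_map 0) ?size_iota; last by lia.
  rewrite nth_iota; last by lia.
  have := nth_rot peps (i := i) (k := k.+1) (s := map val g).
  rewrite size_map size_tuple ltn_ord gE add1n /= nth_rcons kw => <- //; lia.
have [A [Y [W [gE' AE YE WE]]]] : exists A Y W, [/\ rot i g = A :: rcons W Y,
    val A = a, val Y = y & map val W = w].
  move: gE; rewrite -map_rot; case: (rot i g) => // A s [AE].
  case/lastP: s => [|W Y]; first by case: (w).
  by rewrite map_rcons => /rcons_inj[WE YE]; exists A, Y, W.
have n_gt0 := ltnW n_ge2.
have sizeW : n = (size W).+2.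
  by have := congr1 size gE'; rewrite size_rot size_tuple /= size_rcons.
exists i, b, p, q; split.
- have := nth_rot A (i := i) (k := 0) (s := g); rewrite size_tuple ltn_ord n_gt0.
  rewrite gE' addn0 modn_small ?ltn_ord //= => AgE.
  by rewrite (tnth_nth A) -AgE ?AE.
- have predE : val (ord_pred i) = (i + n.-1) %% n.
    by rewrite /=; congr (_ %% _); lia.
  have nthY : nth A (A :: rcons W Y) n.-1 = Y.
    by rewrite sizeW /= nth_rcons ltnn eqxx.
  have := nth_rot A (i := i) (k := n.-1) (s := g).
  rewrite size_tuple ltn_ord ltn_predL n_gt0 gE' nthY -predE => YgE.
  by rewrite (tnth_nth A) -YgE ?YE.
- exists A, Y, W, p, q; split=> //; rewrite ?pinvK ?AE ?YE //.
  by rewrite WE wE.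
- by rewrite fE wE.
Qed.
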